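(* Let $0\leq\varepsilon<1$ and $0<\varepsilon_0<1$, and suppose that $$\tfrac13 h_t^2\Big(\tfrac{a_1^2}{h_1^2}+\ldots+\tfrac{a_n^2}{h_n^2}\Big)\leq 1-\varepsilon\qquad\text{and}\qquad \tfrac14 h_t^2A_{\mathbf h}\leq(1-\varepsilon_0^2)I\ \text{ in }H_h .$$ Let $f_{\mathbf h},b_1,\ldots,b_n:\{t_m\}_{m=0}^{M-1}\to H_h$ and $v^0,u_{1\mathbf h}\in H_h$ be arbitrary. Let $v:\{t_m\}_{m=0}^{M}\to H_h$ (with the given $v^0$) and $v_{11},\ldots,v_{nn}:\{t_m\}_{m=0}^{M-1}\to H_h$ satisfy (homogeneous Dirichlet boundary case) the scheme $$\Lambda_tv^m=\big(I+\tfrac1{12}h_t^2L_h\big)\big(a_1^2v_{11}^m+\ldots+a_n^2v_{nn}^m\big)+f_{\mathbf h}^m\ \text{ on }\omega_h,\quad 1\leq m\leq M-1,\tag{a}$$ $$s_{kN}v_{kk}^m=\Lambda_kv^m+b_k^m\ \text{ on }\omega_h,\quad 0\leq m\leq M-1,\ 1\leq k\leq n,\tag{b}$$ $$(\delta_tv)^0=\tfrac12h_t\big(I+\tfrac1{12}h_t^2L_h\big)\big(a_1^2v_{11}^0+\ldots+a_n^2v_{nn}^0\big)+u_{1\mathbf h}+\tfrac12h_tf_{\mathbf h}^0\ \text{ on }\omega_h.\tag{c}$$ Set $$\beta_{\mathbf h}:=\big(I+\tfrac1{12}h_t^2L_h\big)\big(a_1^2s_{1N}^{-1}b_1+\ldots+a_n^2s_{nN}^{-1}b_n\big)\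 \text{ in }H_h\ \text{ on }\{t_m\}_{m=0}^{M-1}.$$ Then the stability bound $$\max_{1\leq m\leq M}\big(\varepsilon_0^2\|\bar\delta_tv^m\|_h^2+\|\bar s_tv^m\|_{A_{\mathbf h}}^2\big)^{1/2}\leq\big(\|v^0\|_{A_{\mathbf h}}^2+\varepsilon_0^{-2}\|u_{1\mathbf h}\|_h^2\big)^{1/2}+2\varepsilon_0^{-1}\|f_{\mathbf h}+\beta_{\mathbf h}\|_{L^1_{h_t}(H_h)}$$ holds, and, for $1\leq m\leq M$, the discrete energy conservation law $$\|\bar\delta_tv^m\|_h^2-\tfrac14h_t^2\|\bar\delta_tv^m\|_{A_{\mathbf h}}^2+\|\bar s_tv^m\|_{A_{\mathbf h}}^2$$ $$=\|\bar\delta_tv^1\|_h^2-\tfrac14h_t^2\|\bar\delta_tv^1\|_{A_{\mathbf h}}^2+\|\bar s_tv^1\|_{A_{\mathbf h}}^2+2I_{h_t}^{m-1}\big(f_{\mathbf h}+\beta_{\mathbf h},\mathring\delta_tv\big)_h$$ $$=\big(A_{\mathbf h}v^0,s_tv^0\big)_h+\big(u_{1\mathbf h},\delta_tv^0\big)_h+\tfrac12h_t\big(f_{\mathbf h}^0+\beta_{\mathbf h}^0,\delta_tv^0\big)_h+2I_{h_t}^{m-1}\big(f_{\mathbf h}+\beta_{\mathbf h},\mathring\delta_tv\big)_h$$ holds. Moreover, the first equality of the energy law holds for any $v^1\in H_h$, i.e. when (a) and (b) hold but $v^1$ is not necessarily defined by (c).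
   Context: Let $n\geq1$, $a_k>0$, $X_k>0$ ($1\leq k\leq n$), $T>0$ be constants and $\Omega=(0,X_1)\times\ldots\times(0,X_n)$. Time mesh: $t_m=mh_t$, $0\leq m\leq M$, $h_t=T/M$, $M\geq2$. For a function $y$ of the time mesh write $y^m=y(t_m)$ and $\bar s_ty^m=\tfrac12(y^{m-1}+y^m)$, $s_ty^m=\tfrac12(y^m+y^{m+1})$, $\bar\delta_ty^m=\frac{y^m-y^{m-1}}{h_t}$, $\delta_ty^m=\frac{y^{m+1}-y^m}{h_t}$, $\mathring\delta_ty^m=\frac{y^{m+1}-y^{m-1}}{2h_t}$, $\Lambda_ty^m=\frac{y^{m+1}-2y^m+y^{m-1}}{h_t^2}$. Summation operator: $I_{h_t}^my=h_t\sum_{l=1}^my^l$ for $m\geq1$, $I_{h_t}^0y=0$. Space mesh: $x_{kl}=lh_k$, $0\leq l\leq N_k$, $h_k=X_k/N_k$, $N_k\geq2$ an integer; $\bar\omega_h$ is the product of the one-dimensional meshes $\{x_{kl}\}_{l=0}^{N_k}$, $1\le k\le n$, $\omega_h$ is the product of $\{x_{kl}\}_{l=1}^{N_k-1}$, and $\partial\omega_h=\bar\omega_h\setminus\omega_h$; $h=(h_1,\ldots,h_n)$, $\mathbf h=(h,h_t)$. In the direction $x_k$ on $\omega_h$: $(\Lambda_kw)_l=\frac{1}{h_k^2}(w_{l+1}-2w_l+w_{l-1})$ and the Numerov average $s_{kN}w_l=\frac1{12}(w_{l-1}+10w_l+w_{l+1})$, i.e. $s_{kN}=I+\frac1{12}h_k^2\Lambda_k$.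 Also $L_h=a_1^2\Lambda_1+\ldots+a_n^2\Lambda_n$; $I$ is the identity. $H_h$ is the Euclidean space of real functions on $\bar\omega_h$ vanishing on $\partial\omega_h$ with inner product $(v,w)_h=h_1\cdots h_n\sum_{x\in\omega_h}v(x)w(x)$ and norm $\|w\|_h=(w,w)_h^{1/2}$. The operators $\Lambda_k,s_{kN},L_h$ are regarded as operators in $H_h$ (their values on $\partial\omega_h$ are set to $0$); $s_{kN}$ is invertible in $H_h$. Operator inequalities in $H_h$ are in the sense of quadratic forms. For $C_h=C_h^*>0$ in $H_h$, $\|w\|_{C_h}=(C_hw,w)_h^{1/2}$. $A_{\mathbf h}:=\big(I+\tfrac1{12}h_t^2L_h\big)\big(-a_1^2s_{1N}^{-1}\Lambda_1-\ldots-a_n^2s_{nN}^{-1}\Lambda_n\big)$ in $H_h$; it is self-adjoint, and positive definite under the first displayed condition of the claim. For $y:\{t_m\}_{m=0}^{M-1}\to H_h$: $\|y\|_{L^1_{h_t}(H_h)}:=\tfrac14h_t\|y^0\|_h+I_{h_t}^{M-1}\|y\|_h=\tfrac14h_t\|y^0\|_h+h_t\sum_{l=1}^{M-1}\|y^l\|_h$. *)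

(* Defs.v *)
From HB Require Import structures.
From mathcomp Require Import all_boot all_order all_algebra.
From mathcomp Require Import reals.
From mathcomp Require Import ring lra.
Set Implicit Arguments.
Unset Strict Implicit.
Unset Printing Implicit Defensive.
Import Order.TTheory GRing.Theory Num.Theory.
Local Open Scope ring_scope.

(* Node (l_1, .., l_n) stands for the point (l_1 h_1, .., l_n h_n), with
   0 <= l_k <= N_k: the mesh is indexed by multi-indices. *)
Definition mesh (n : nat) (N : 'I_n -> nat) : finType :=
  {dffun forall k : 'I_n, 'I_(N k).+1}.

Definition omega (n : nat) (N : 'I_n -> nat) : {set mesh N} :=
  [set x : mesh N | [forall k, (0 < x k < N k)%N]].

(* The node x with its k-th index replaced by l; [inord] is junk for l > N k,
   a case which does not arise for the neighbours of an interior node. *)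
Definition setk (n : nat) (N : 'I_n -> nat) (x : mesh N) (k : 'I_n) (l : nat) :
  mesh N := [ffun j => dfwith x (inord l : 'I_(N k).+1) j].

Section SpaceMesh.
Variables (R : realType) (n : nat) (N : 'I_n -> nat).

Definition mfun := {ffun mesh N -> R^o}.

Definition Hsub : {vspace mfun} :=
  (\bigcap_(x in ~: omega N) lker (linfun (fun w : mfun => w x)))%VS.

Fact mfun_eval_linear (x : mesh N) : linear (fun w : mfun => w x).
Proof. by move=> c u w; rewrite !ffunE. Qed.

Lemma HsubP (w : mfun) :
  reflect (forall x, x \notin omega N -> w x = 0) (w \in Hsub).
Proof.
have ev x : linfun (fun w : mfun => w x) w = w x.
  pose F := GRing.isLinear.Build R mfun R^o _ _ (mfun_eval_linear x).
  pose L : {linear mfun -> R^o} := HB.pack (fun w : mfun => w x) F.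
  exact: (lfunE L w).
apply: (iffP idP) => [wH x xN | w0].
  have /subvP/(_ _ wH) : (Hsub <= lker (linfun (fun w : mfun => w x)))%VS.
    by apply: (@bigcapv_inf _ _ _ x) => //; rewrite inE.
  by rewrite memv_ker ev => /eqP.
rewrite memvE; apply/subv_bigcapP => x; rewrite inE => xN.
by rewrite -memvE memv_ker ev w0.
Qed.

Definition Hh : Type := subvs_of Hsub.
HB.instance Definition _ := Vector.on Hh.

Definition Hval (w : Hh) (x : mesh N) : R := (vsval w : mfun) x.
Coercion Hval : Hh >-> Funclass.

(* The element of Hh equal to g on omega, and to 0 on the boundary. *)
Definition mkH (g : mesh N -> R) : Hh :=
  vsproj Hsub ([ffun x => if x \in omega N then g x else 0] : mfun).

Lemma mkHE g x : mkH g x = if x \in omega N then g x else 0.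
Proof.
rewrite /Hval /mkH vsprojK ?ffunE //.
by apply/HsubP => y /negbTE yN; rewrite ffunE yN.
Qed.

Lemma HvalN w x : x \notin omega N -> Hval w x = 0.
Proof. by move=> xN; apply: (HsubP _ (subvsP w)). Qed.

Lemma HvalP (v w : Hh) : (forall x, x \in omega N -> v x = w x) -> v = w.
Proof.
move=> vw; apply/val_inj/ffunP => x.
have [/vw //|xN] := boolP (x \in omega N).
by rewrite -[LHS]/(v x) -[RHS]/(w x) !HvalN.
Qed.

Lemma HvalD (v w : Hh) x : Hval (v + w) x = v x + w x.
Proof. by rewrite /Hval /= ffunE. Qed.

Lemma HvalZ c (w : Hh) x : Hval (c *: w) x = c * w x.
Proof. by rewrite /Hval /= ffunE. Qed.

Variables h : 'I_n -> R.

Definition Lam_fun (k : 'I_n) (w : Hh) : Hh :=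
  mkH (fun x => (w (setk x k (x k).+1) - 2 * w x + w (setk x k (x k).-1))
                / h k ^+ 2).

Definition sN_fun (k : 'I_n) (w : Hh) : Hh :=
  mkH (fun x => (w (setk x k (x k).-1) + 10 * w x + w (setk x k (x k).+1))
                / 12).

Fact Lam_fun_linear k : linear (Lam_fun k).
Proof.
move=> c u w; apply: HvalP => x xI.
by rewrite HvalD HvalZ !mkHE xI !HvalD !HvalZ; ring.
Qed.
HB.instance Definition _ k :=
  GRing.isLinear.Build R Hh Hh _ (Lam_fun k) (Lam_fun_linear k).

Fact sN_fun_linear k : linear (sN_fun k).
Proof.
move=> c u w; apply: HvalP => x xI.
by rewrite HvalD HvalZ !mkHE xI !HvalD !HvalZ; ring.
Qed.
HB.instance Definition _ k :=
  GRing.isLinear.Build R Hh Hh _ (sN_fun k) (sN_fun_linear k).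

Definition Lam k : 'End(Hh) := linfun (Lam_fun k).
Definition sN k : 'End(Hh) := linfun (sN_fun k).

Lemma LamE k (w : Hh) x : x \in omega N ->
  Hval (Lam k w) x =
  (w (setk x k (x k).+1) - 2 * w x + w (setk x k (x k).-1)) / h k ^+ 2.
Proof. by move=> xI; rewrite lfunE /= mkHE xI. Qed.

Lemma sNE k (w : Hh) x : x \in omega N ->
  Hval (sN k w) x =
  (w (setk x k (x k).-1) + 10 * w x + w (setk x k (x k).+1)) / 12.
Proof. by move=> xI; rewrite lfunE /= mkHE xI. Qed.

Lemma sN_Lam k : h k != 0 -> sN k = (\1 + (h k ^+ 2 / 12) *: Lam k)%VF.
Proof.
move=> hk; apply/lfunP => w; apply: HvalP => x xI.
rewrite add_lfunE scale_lfunE id_lfunE HvalD HvalZ sNE // LamE //.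
by field; rewrite hk.
Qed.

(* Hence (sN k)^-1%VF is the genuine two-sided inverse of sN k in Hh. *)
Lemma sN_inj k : lker (sN k) == 0%VS.
Proof.
apply/lker0P => u w /eqP; rewrite -subr_eq0 -linearB => /eqP s0.
apply/eqP; rewrite -subr_eq0; move: s0; set d : Hh := u - w => s0; apply/eqP.
have max_d (x0 : mesh N) : exists x, forall y, `|d y| <= `|d x|.
  have [x _ xmax] := @arg_maxP _ R _ x0 predT (fun x => `|d x|) isT.
  by exists x => y; apply: xmax.
apply: HvalP => x0 _; have [x xmax] := max_d x0.
have dx0 : d x = 0.
  have [xI|xN] := boolP (x \in omega N); last exact: HvalN.
  have := congr1 (fun w : Hh => w x) s0; rewrite sNE // => sx.
  have := xmax (setk x k (x k).-1); have := xmax (setk x k (x k).+1).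
  have z0 : Hval 0 x = 0 by rewrite /Hval /= ffunE.
  rewrite z0 in sx; move: sx.
  move: (d x) (d (setk x k _.-1)) (d (setk x k _.+1)) => a b c sx lc lb.
  apply/eqP; rewrite -normr_eq0 eq_le normr_ge0 andbT.
  have e : 10 * a = - (c + b) by lra.
  have := ler_normD c b; rewrite -normrN -e normrM.
  have -> : `|10 : R| = 10 by rewrite normr_nat.
  lra.
have := xmax x0; rewrite dx0 normr0 normr_le0 => /eqP ->.
by rewrite /Hval /= ffunE.
Qed.

Variables (a : 'I_n -> R) (ht : R).

Definition Lh : 'End(Hh) := \sum_k a k ^+ 2 *: Lam k.

Definition Ph : 'End(Hh) := (\1 + (ht ^+ 2 / 12) *: Lh)%VF.

Definition Ah : 'End(Hh) :=
  (Ph \o (\sum_k - (a k ^+ 2) *: ((sN k)^-1 \o Lam k)))%VF.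

Definition betah (b : 'I_n -> nat -> Hh) (m : nat) : Hh :=
  Ph (\sum_k a k ^+ 2 *: (sN k)^-1%VF (b k m)).

Definition dotH (v w : Hh) : R :=
  (\prod_k h k) * \sum_(x in omega N) v x * w x.

Definition normH (w : Hh) : R := Num.sqrt (dotH w w).

Definition normC (C : 'End(Hh)) (w : Hh) : R := Num.sqrt (dotH (C w) w).

Definition leC (B C : 'End(Hh)) : Prop :=
  forall w : Hh, dotH (B w) w <= dotH (C w) w.

End SpaceMesh.

(* Functions on the time mesh are sequences indexed by nat, of which only the
   values at the levels of the mesh are ever used; [bst] and [bdt] are
   meant for m >= 1, as are [mdt] and [Lamt]. *)
Section TimeMesh.
Variables (R : realType) (V : lmodType R) (ht : R).
Implicit Types (y : nat -> V) (m : nat).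

Definition bst y m : V := 2^-1 *: (y m.-1 + y m).
Definition st y m : V := 2^-1 *: (y m + y m.+1).
Definition bdt y m : V := ht^-1 *: (y m - y m.-1).
Definition dt y m : V := ht^-1 *: (y m.+1 - y m).
Definition mdt y m : V := (2 * ht)^-1 *: (y m.+1 - y m.-1).
Definition Lamt y m : V := (ht ^+ 2)^-1 *: (y m.+1 - 2 *: y m + y m.-1).

Definition It (m : nat) (y : nat -> R) : R := ht * \sum_(1 <= l < m.+1) y l.

End TimeMesh.

Definition normL1 (R : realType) (n : nat) (N : 'I_n -> nat) (h : 'I_n -> R)
    (ht : R) (M : nat) (y : nat -> Hh R N) : R :=
  4^-1 * ht * normH h (y 0%N) + It ht M.-1 (fun l => normH h (y l)).

Definition energy (R : realType) (n : nat) (N : 'I_n -> nat) (h a : 'I_n -> R)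
    (ht : R) (v : nat -> Hh R N) (m : nat) : R :=
  normH h (bdt ht v m) ^+ 2
  - 4^-1 * ht ^+ 2 * normC h (Ah N h a ht) (bdt ht v m) ^+ 2
  + normC h (Ah N h a ht) (bst v m) ^+ 2.

(* Main.v *)
(* Eliminating the v_kk gives Lambda_t v + A v = f + beta, and (c) becomes
   (delta_t v)^0 = u_1 + (h_t / 2) ((f + beta)^0 - A v^0). As A is self-adjoint,
   the energy at level m + 1 equals |delta_t v^m|^2 + (A v^m, v^(m+1)), and
   pairing the scheme with the central difference of v gives its increments.
   The bound on h_t^2 A / 4 makes the energy dominate the left-hand side Y_m^2
   of the stability bound; by Cauchy-Schwarz it is at most (max Y) times the
   right-hand side.

   Nonnegativity of A: the Lambda_k are sums of commuting mesh shifts, hence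
   commute and satisfy -4 / h_k^2 <= Lambda_k <= 0, so that I + h_t^2 L_h / 12
   is nonnegative by the first condition, and a product of commuting
   nonnegative self-adjoint operators is nonnegative. *)
Require Import Defs.
From HB Require Import structures.
From mathcomp Require Import all_boot all_order all_algebra.
From mathcomp Require Import reals.
From mathcomp Require Import ring lra.
Set Implicit Arguments.
Unset Strict Implicit.
Unset Printing Implicit Defensive.
Import Order.TTheory GRing.Theory Num.Theory.
Local Open Scope ring_scope.

(** * Semidefinite forms and self-adjoint operators *)

(** Semidefinite rather than definite, so as to cover also [q (A u) v] and the sum form on [V * V]
    used in [energy_stability]. *)
Record psd_form (R : realFieldType) (V : lmodType R) (q : V -> V -> R) :
    Prop := PsdForm {
  psdC : forall u v, q u v = q v u;
  psdDl : forall u v w, q (u + v) w = q u w + q v w;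
  psdZl : forall c u w, q (c *: u) w = c * q u w;
  psd_ge0 : forall u, 0 <= q u u
}.

Section PsdForm.
Variables (R : realFieldType) (V : lmodType R) (q : V -> V -> R).
Hypothesis q_psd : psd_form q.

Lemma psdDr u v w : q u (v + w) = q u v + q u w.
Proof. by rewrite !(psdC q_psd u) (psdDl q_psd). Qed.

Lemma psdZr c u w : q u (c *: w) = c * q u w.
Proof. by rewrite !(psdC q_psd u) (psdZl q_psd). Qed.

Lemma psdNl u w : q (- u) w = - q u w.
Proof. by rewrite -scaleN1r (psdZl q_psd) mulN1r. Qed.

Lemma psdNr u w : q u (- w) = - q u w.
Proof. by rewrite -scaleN1r psdZr mulN1r. Qed.

Definition psdE := (psdDl q_psd, psdDr, psdZl q_psd, psdZr, psdNl, psdNr).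

Lemma psd_CS_sqr u v : q u v ^+ 2 <= q u u * q v v.
Proof.
have quu := psd_ge0 q_psd u; have qvv := psd_ge0 q_psd v.
have P c d : 0 <= c ^+ 2 * q u u + 2 * (c * d) * q u v + d ^+ 2 * q v v.
  have := psd_ge0 q_psd (c *: u + d *: v).
  by rewrite !psdE (psdC q_psd v u); congr (0 <= _); ring.
have [qv0|qv0] := eqVneq (q v v) 0; last first.
  have qv_gt0 : 0 < q v v by rewrite lt_neqAle eq_sym qv0.
  have := P (q v v) (- q u v).
  rewrite (_ : _ + _ = q v v * (q u u * q v v - q u v ^+ 2)); last by ring.
  by rewrite pmulr_rge0 // subr_ge0.
have [->|qu0] := eqVneq (q u v) 0; first by rewrite qv0 mulr0 expr0n.
(* With [q v v = 0] the expression in [P] is affine in [d]; this [d] makes it equal to -1. *)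
have := P 1 (- (q u u + 1) / (2 * q u v)).
rewrite qv0 mulr0 addr0 expr1n !mul1r.
rewrite (_ : 2 * (- (q u u + 1) / (2 * q u v)) * q u v = - (q u u + 1)).
  lra.
by field.
Qed.

End PsdForm.

Lemma psd_CS (R : rcfType) (V : lmodType R) (q : V -> V -> R) u v :
  psd_form q -> q u v <= Num.sqrt (q u u) * Num.sqrt (q v v).
Proof.
move=> q_psd; apply: le_trans (ler_norm _) _.
rewrite -sqrtr_sqr -sqrtrM ?(psd_ge0 q_psd) // ler_sqrt ?psd_CS_sqr //.
by rewrite mulr_ge0 ?(psd_ge0 q_psd).
Qed.

Definition self_adjoint (R : realFieldType) (V : vectType R)
    (q : V -> V -> R) (A : 'End(V)) := forall u v, q (A u) v = q u (A v).

Definition nonneg_op (R : realFieldType) (V : vectType R)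
    (q : V -> V -> R) (A : 'End(V)) := forall u, 0 <= q (A u) u.

Lemma psd_form_op (R : realFieldType) (V : vectType R) (q : V -> V -> R)
    (A : 'End(V)) :
  psd_form q -> self_adjoint q A -> nonneg_op q A ->
  psd_form (fun u v => q (A u) v).
Proof.
move=> q_psd Asym A0; split=> // [u v|u v w|c u w].
- by rewrite Asym (psdC q_psd).
- by rewrite linearD (psdDl q_psd).
- by rewrite linearZ /= (psdZl q_psd).
Qed.

(** A - A^2 = A (I - A)^2 + A^2 (I - A), where both terms are nonnegative: the first is the form of
    A at u - A u, the second that of I - A at A u. *)
Lemma nonneg_op_sqr_le (R : realFieldType) (V : vectType R)
    (q : V -> V -> R) (A : 'End(V)) u :
  psd_form q -> self_adjoint q A -> nonneg_op q A ->
  (forall u, q (A u) u <= q u u) -> q (A u) (A u) <= q (A u) u.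
Proof.
move=> q_psd Asym A0 A1.
have := A0 (u - A u); have := A1 (A u).
rewrite linearB /= !(psdE q_psd) [q (A (A u)) u]Asym; lra.
Qed.

(** * Products of commuting nonnegative operators *)

Section OperatorProduct.
Variables (R : archiRealFieldType) (V : vectType R) (q : V -> V -> R).
Hypothesis q_psd : psd_form q.

Let next (A : 'End(V)) : 'End(V) := A - (A \o A)%VF.

Let nextE A u : next A u = A u - A (A u).
Proof. by rewrite /next add_lfunE opp_lfunE comp_lfunE. Qed.

(* Riesz's argument, avoiding square roots: with [A_(j+1) = A_j - A_j ^ 2]
   one has [A = A_0 ^ 2 + ... + A_(j-1) ^ 2 + A_j], where [A_j w] tends to 0,
   and [(A_j (B (A_j w)), w) = (B (A_j w), A_j w) >= 0]. *)
Lemma nonneg_comp (A B : 'End(V)) :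
  self_adjoint q A -> nonneg_op q A -> (forall u, q (A u) u <= q u u) ->
  nonneg_op q B -> (forall u, A (B u) = B (A u)) -> nonneg_op q (A \o B)%VF.
Proof.
move=> Asym A0 A1 B0 AB w; rewrite comp_lfunE leNgt; apply/negP => ABneg.
pose S j := iter j next A.
have SP j : [/\ self_adjoint q (S j), nonneg_op q (S j),
    (forall u, q (S j u) u <= q u u) & (forall u, S j (B u) = B (S j u))].
  elim: j => [|j [sym ge le com]] //; rewrite /S iterS -/(S j).
  split=> [u z|u|u|u]; rewrite !nextE.
  - by rewrite !(psdE q_psd) !sym.
  - have := nonneg_op_sqr_le u q_psd sym ge le.
    by rewrite !(psdE q_psd) [q (S j (S j u)) u]sym; lra.
  - have := le u; have := psd_ge0 q_psd (S j u).
    rewrite !(psdE q_psd) !sym; lra.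
  - by rewrite !com linearB.
have dec j : q (S j.+1 (B w)) w <= q (S j (B w)) w.
  have [sym _ _ com] := SP j; rewrite {1}/S iterS -/(S j) nextE !(psdE q_psd).
  rewrite [q (S j (S j (B w))) w]sym com; have := B0 (S j w); lra.
(* The quantity [- q (S j (B w)) w] never falls below its initial value [d], so Cauchy-Schwarz
   bounds every [q (S j w) (S j w) * q (B w) (B w)] below by [d ^+ 2]. By [tel] the sums of
   [q (S j w) (S j w)] stay below [q (A w) w], which contradicts the Archimedean property. *)
pose d := - q (A (B w)) w.
have d_gt0 : 0 < d by rewrite oppr_gt0.
have Sd j : d <= - q (S j (B w)) w.
  by elim: j => // j IH; rewrite (le_trans IH) // lerN2 dec.
have tel j : q (A w) w = \sum_(i < j) q (S i w) (S i w) + q (S j w) w.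
  elim: j => [|j IH]; first by rewrite big_ord0 add0r.
  have [sym _ _ _] := SP j.
  by rewrite IH big_ord_recr /= nextE !(psdE q_psd) [q (S j (S j w)) w]sym; lra.
have sq j : d ^+ 2 <= q (S j w) (S j w) * q (B w) (B w).
  have [sym _ _ _] := SP j.
  rewrite mulrC; apply: le_trans (psd_CS_sqr q_psd (B w) (S j w)).
  rewrite -sym -[leRHS]sqrrN ler_pXn2r ?nnegrE ?(ltW d_gt0) //.
  by apply: le_trans (Sd j); apply: ltW.
have key j : j%:R * d ^+ 2 <= q (A w) w * q (B w) (B w).
  have [_ ge _ _] := SP j.
  have := mulr_ge0 (ge w) (psd_ge0 q_psd (B w)).
  have : j%:R * d ^+ 2 <= \sum_(i < j) q (S i w) (S i w) * q (B w) (B w).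
    rewrite mulrC mulr_natr -[X in _ *+ X]card_ord -sumr_const.
    exact: ler_sum.
  by rewrite (tel j) mulrDl -mulr_suml; lra.
have d2 : 0 < d ^+ 2 by rewrite exprn_gt0.
pose C := q (A w) w * q (B w) (B w).
have C0 : 0 <= C / d ^+ 2.
  by rewrite divr_ge0 ?(ltW d2) // mulr_ge0 ?(psd_ge0 q_psd).
by have := archi_boundP C0; rewrite ltr_pdivrMr // ltNge key.
Qed.

End OperatorProduct.

Lemma self_adjoint_inv (R : realFieldType) (V : vectType R)
    (q : V -> V -> R) (A : 'End(V)) :
  lker A == 0%VS -> self_adjoint q A -> self_adjoint q (A^-1)%VF.
Proof.
move=> kA As u v.
by rewrite -{1}[v](lker0_lfunVK kA) -As (lker0_lfunVK kA).
Qed.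

(** * Energy method for the abstract three-level equation *)

Section EnergyMethod.
Variables (R : realType) (V : vectType R) (q : V -> V -> R) (A : 'End(V)).
Variables (ht : R) (v g : nat -> V).
Hypotheses (q_psd : psd_form q) (A_sym : self_adjoint q A) (ht_gt0 : 0 < ht).

Definition op_energy m : R :=
  q (bdt ht v m) (bdt ht v m)
  - 4^-1 * ht ^+ 2 * q (A (bdt ht v m)) (bdt ht v m)
  + q (A (bst v m)) (bst v m).

(** Polarization: with s the mean and r half the increment of v over the step, (A s, s) - (A r, r) =
    (A (s - r), s + r). *)
Lemma op_energyE m :
  op_energy m.+1 = q (dt ht v m) (dt ht v m) + q (A (v m)) (v m.+1).
Proof.
rewrite /op_energy /bdt /bst /dt /= !(linearZ, linearD, linearN) /=.
rewrite !(psdE q_psd) (_ : q (A (v m.+1)) (v m) = q (A (v m)) (v m.+1)).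
  by field; rewrite lt0r_neq0.
by rewrite A_sym (psdC q_psd).
Qed.

(** The vector [2 * ht *: mdt] is both [ht] times the sum of two consecutive [dt], while [Lamt] is
    their difference over [ht], and the two-step increment of v. Hence both parts of the pairing are
    differences of consecutive terms of [op_energyE]. *)
Lemma op_energyS m :
  op_energy m.+2 =
  op_energy m.+1 + 2 * ht * q (Lamt ht v m.+1 + A (v m.+1)) (mdt ht v m.+1).
Proof.
rewrite !op_energyE /Lamt /mdt /dt /= !(psdE q_psd).
rewrite (_ : q (A (v m.+1)) (v m) = q (A (v m)) (v m.+1)); last first.
  by rewrite A_sym (psdC q_psd).
rewrite (psdC q_psd (v m.+1) (v m)) (psdC q_psd (v m.+2) (v m)).
rewrite (psdC q_psd (v m.+2) (v m.+1)).
by field; rewrite lt0r_neq0.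
Qed.

Lemma op_energy_law (M : nat) :
  (forall m, (1 <= m <= M.-1)%N -> Lamt ht v m + A (v m) = g m) ->
  forall m, (1 <= m <= M)%N ->
  op_energy m =
  op_energy 1 + 2 * It ht m.-1 (fun l => q (g l) (mdt ht v l)).
Proof.
move=> eqn [|m] // /andP[_]; elim: m => [|m IH] mM.
  by rewrite /It /= big_geq // !mulr0 addr0.
rewrite op_energyS IH; last exact: ltnW.
rewrite eqn /=; last by rewrite -ltnS prednK //; apply: leq_trans mM.
by rewrite /It (big_nat_recr m.+1) //=; ring.
Qed.

(** Pairing the initial condition with d = [dt ht v 0] expresses |d|^2; its term -(ht / 2) (A v^0,
    d) turns (A v^0, v^1) into (A v^0, [st v 0]). *)
Lemma op_energy_init (u1 : V) :
  dt ht v 0 = u1 + (2^-1 * ht) *: (g 0%N - A (v 0%N)) ->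
  op_energy 1 =
  q (A (v 0%N)) (st v 0) + q u1 (dt ht v 0)
  + 2^-1 * ht * q (g 0%N) (dt ht v 0).
Proof.
rewrite op_energyE => dt0.
set d := dt ht v 0 in dt0 *.
have v1 : v 1%N = v 0%N + ht *: d.
  by rewrite /d /dt scalerA mulfV ?lt0r_neq0 // scale1r addrC subrK.
have -> : u1 = d - (2^-1 * ht) *: (g 0%N - A (v 0%N)) by rewrite dt0 addrK.
by clearbody d; rewrite /st v1 !(psdE q_psd); field.
Qed.

Variables (M : nat) (eps0 : R) (u1 : V).
Hypothesis A_ge0 : nonneg_op q A.
Hypothesis eps0_gt0 : 0 < eps0.
Hypothesis A_le :
  forall w, 4^-1 * ht ^+ 2 * q (A w) w <= (1 - eps0 ^+ 2) * q w w.
Hypothesis eqn : forall m, (1 <= m <= M.-1)%N -> Lamt ht v m + A (v m) = g m.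
Hypothesis init : dt ht v 0 = u1 + (2^-1 * ht) *: (g 0%N - A (v 0%N)).

Let nrm w := Num.sqrt (q w w).
Let y m := Num.sqrt (eps0 ^+ 2 * q (bdt ht v m) (bdt ht v m)
                     + q (A (bst v m)) (bst v m)).

Let y_sqr m : y m ^+ 2 = eps0 ^+ 2 * q (bdt ht v m) (bdt ht v m)
                     + q (A (bst v m)) (bst v m).
Proof.
rewrite sqr_sqrtr // addr_ge0 ?A_ge0 //.
by rewrite mulr_ge0 ?sqr_ge0 ?(psd_ge0 q_psd).
Qed.

Let y_ge_bdt m : eps0 * nrm (bdt ht v m) <= y m.
Proof.
rewrite -(ler_pXn2r (n := 2)) ?nnegrE ?mulr_ge0 ?sqrtr_ge0 ?(ltW eps0_gt0) //.
by rewrite y_sqr exprMn sqr_sqrtr ?(psd_ge0 q_psd) // lerDl A_ge0.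
Qed.

Let dot_le_bdt w m : q w (bdt ht v m) <= eps0^-1 * nrm w * y m.
Proof.
apply: le_trans (psd_CS _ _ q_psd) _; rewrite -/(nrm _) -/(nrm _).
rewrite mulrC -mulrA [_ * y m]mulrC mulrA ler_wpM2r ?sqrtr_ge0 //.
by rewrite ler_pdivlMl // y_ge_bdt.
Qed.

Lemma energy_stability : (0 < M)%N ->
  \big[Num.max/0]_(1 <= m < M.+1) y m
  <= Num.sqrt (q (A (v 0%N)) (v 0%N) + eps0 ^- 2 * q u1 u1)
     + 2 * eps0^-1 * (4^-1 * ht * nrm (g 0%N)
                      + It ht M.-1 (fun l => nrm (g l))).
Proof.
move=> M0.
set K := Num.sqrt _; set G := _ + It _ _ _.
set Y := \big[Num.max/0]_(1 <= m < M.+1) y m.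
have y_le l : (1 <= l <= M)%N -> y l <= Y.
  by move=> lM; apply: le_bigmax_seq => //; rewrite mem_index_iota ltnS.
have M1 : (1 <= 1 <= M)%N by rewrite M0.
have Y0 : 0 <= Y by apply: le_trans (y_le 1%N M1); apply: sqrtr_ge0.
have e1 := ltW eps0_gt0; have h0 := ltW ht_gt0.
have ie : 0 <= eps0^-1 by rewrite invr_ge0.
(* One Cauchy-Schwarz inequality in [V * V], with the weight [eps0] moved onto [d] and its inverse
   onto [u1], keeps both data under a single root. *)
have CS s d : q (A (v 0%N)) s + q u1 d
    <= K * Num.sqrt (eps0 ^+ 2 * q d d + q (A s) s).
  pose p (w w' : (V * V)%type) := q (A w.1) w'.1 + q w.2 w'.2.
  have qA := psd_form_op q_psd A_sym A_ge0.
  have p_psd : psd_form p.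
    split=> [w w'|w1 w2 w|c w w'|w]; rewrite /p /=.
    - by rewrite (psdC qA) (psdC q_psd w.2).
    - by rewrite (psdDl qA) (psdDl q_psd); ring.
    - by rewrite (psdZl qA) (psdZl q_psd); ring.
    - by rewrite addr_ge0 ?A_ge0 ?(psd_ge0 q_psd).
  have := psd_CS (v 0%N, eps0^-1 *: u1) (s, eps0 *: d) p_psd.
  rewrite /p /= !(psdE q_psd) /K mulrA mulVf ?lt0r_neq0 // mul1r.
  by rewrite !mulrA -invfM -!expr2 [q (A s) s + _]addrC.
have start : q (A (v 0%N)) (st v 0) + q u1 (dt ht v 0) <= K * Y.
  apply: le_trans (CS (bst v 1) (bdt ht v 1)) _.
  by rewrite ler_wpM2l ?sqrtr_ge0 ?(y_le 1%N).
(* The weight [2^-1 * ht] is twice the [4^-1 * ht] that [g 0] carries in the final norm, which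
   yields the common factor 2. *)
have force : 2^-1 * ht * q (g 0%N) (dt ht v 0)
    <= 2^-1 * ht * (eps0^-1 * nrm (g 0%N) * Y).
  rewrite ler_wpM2l ?mulr_ge0 ?invr_ge0 //.
  apply: le_trans (dot_le_bdt (g 0%N) 1) _.
  by rewrite ler_wpM2l ?y_le ?mulr_ge0 ?sqrtr_ge0.
have nrm_sum k : 0 <= \sum_(1 <= l < k) nrm (g l).
  by apply: sumr_ge0 => l _; apply: sqrtr_ge0.
have work k : (1 <= k <= M)%N ->
    It ht k.-1 (fun l => q (g l) (mdt ht v l))
    <= eps0^-1 * It ht M.-1 (fun l => nrm (g l)) * Y.
  case: k => // k /andP[_ kM]; rewrite /It /= prednK //.
  set S := \sum_(1 <= l < M) _.
  rewrite (_ : _ * Y = ht * (eps0^-1 * S * Y)); last by ring.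
  rewrite ler_wpM2l //.
  apply: le_trans (_ : eps0^-1 * (\sum_(1 <= l < k.+1) nrm (g l)) * Y <= _).
    rewrite mulr_sumr mulr_suml; apply: ler_sum_nat => l /andP[l1 lk].
    (* The central difference is the mean of two backward differences, each controlled by [Y]. *)
    have -> : mdt ht v l = 2^-1 *: (bdt ht v l + bdt ht v l.+1).
      rewrite /mdt /bdt /= -scalerDr scalerA invfM; congr (_ *: _).
      by rewrite [RHS]addrC addrA subrK.
    have lM : (l < M)%N := leq_trans lk kM.
    have B j : (1 <= j <= M)%N ->
        q (g l) (bdt ht v j) <= eps0^-1 * nrm (g l) * Y.
      move=> jM; apply: le_trans (dot_le_bdt _ _) _.
      by rewrite ler_wpM2l ?y_le ?mulr_ge0 ?sqrtr_ge0.
    rewrite (psdZr q_psd) (psdDr q_psd); have := B l; have := B l.+1.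
    by rewrite l1 (ltnW lM) lM => /(_ isT) b1 /(_ isT); lra.
  rewrite ler_wpM2r // ler_wpM2l // /S [leRHS](big_cat_nat (n := k.+1)) //=.
  by rewrite lerDl sumr_ge0 // => l _; apply: sqrtr_ge0.
(* By [A_le] the term subtracted in the energy takes at most the fraction [1 - eps0 ^+ 2] of the
   squared norm of [bdt]; what remains is [y k ^+ 2]. *)
have sq k : (1 <= k <= M)%N -> y k ^+ 2 <= (K + 2 * eps0^-1 * G) * Y.
  move=> kM; rewrite y_sqr.
  have := A_le (bdt ht v k); have := op_energy_law eqn kM.
  rewrite (op_energy_init init) {1}/op_energy.
  by have := work k kM; rewrite /G; lra.
have G0 : 0 <= K + 2 * eps0^-1 * G.
  by rewrite !(addr_ge0, mulr_ge0, sqrtr_ge0, invr_ge0, nrm_sum).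
have Y_le : Y <= Num.sqrt ((K + 2 * eps0^-1 * G) * Y).
  rewrite {1}/Y big_nat_cond; apply: bigmax_le => [|k]; first exact: sqrtr_ge0.
  rewrite ltnS andbT => kM.
  have := ler_wsqrtr (sq k kM); rewrite sqrtr_sqr ger0_norm //.
  exact: sqrtr_ge0.
(* Otherwise [Y] is positive and can be cancelled from Y^2 <= (K + 2 G / eps0) Y. *)
have [//|Y_gt] := leP Y (K + 2 * eps0^-1 * G).
have Y_gt0 := le_lt_trans G0 Y_gt.
move: Y_le; rewrite -(ler_pXn2r (n := 2)) ?nnegrE ?sqrtr_ge0 //.
by rewrite sqr_sqrtr ?mulr_ge0 // expr2 ler_pM2r // leNgt Y_gt.
Qed.

End EnergyMethod.

(** * Neighbouring nodes of the mesh *)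

Section Shift.
Variables (n : nat) (N : 'I_n -> nat).
Implicit Types (x : mesh N) (k j : 'I_n) (up d e : bool).

Definition step up (i : nat) : nat := if up then i.+1 else i.-1.

Definition nbr up k x : mesh N := setk x k (step up (x k)).

Lemma omegaP x : reflect (forall k, (0 < x k < N k)%N) (x \in omega N).
Proof. by rewrite inE; apply: forallP. Qed.

Lemma setk_eq x k (l : nat) : (l <= N k)%N -> setk x k l k = l :> nat.
Proof. by move=> lN; rewrite /setk ffunE dfwith_in inordK. Qed.

Lemma setk_neq x k j (l : nat) : k != j -> setk x k l j = x j.
Proof. by move=> kj; rewrite /setk ffunE dfwith_out. Qed.

Lemma mesh_eqP x x' : (forall k, x k = x' k :> nat) -> x = x'.
Proof. by move=> xx'; apply/ffunP => k; apply/val_inj/xx'. Qed.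

Lemma step_le up x k : x \in omega N -> (step up (x k) <= N k)%N.
Proof.
move=> /omegaP/(_ k)/andP[_ xN]; case: up => //=.
exact: leq_trans (leq_pred _) (ltnW xN).
Qed.

Lemma nbr_eq up k x : x \in omega N -> nbr up k x k = step up (x k) :> nat.
Proof. by move=> xI; rewrite setk_eq // step_le. Qed.

Lemma nbrK up k x : x \in omega N -> nbr (~~ up) k (nbr up k x) = x.
Proof.
move=> xI; apply: mesh_eqP => j; have [<-|kj] := eqVneq k j.
  have st : step (~~ up) (step up (x k)) = x k.
    by have /omegaP/(_ k)/andP[+ _] := xI; case: up => //= /prednK.
  rewrite setk_eq nbr_eq // st //.
  by have /omegaP/(_ k)/andP[_ /ltnW] := xI.
by rewrite !setk_neq.
Qed.

Lemma nbr_in up k x : nbr up k x k = inord (step up (x k)).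
Proof. by rewrite /nbr /setk ffunE dfwith_in. Qed.

Lemma nbr_out up k j x : k != j -> nbr up k x j = x j.
Proof. exact: setk_neq. Qed.

(** Each move reads and changes only its own coordinate, so the identity covers the junk values of
    [inord] as well. *)
Lemma nbr_comm d e k j x :
  k != j -> nbr d k (nbr e j x) = nbr e j (nbr d k x).
Proof.
move=> kj; have jk : j != k by rewrite eq_sym.
apply: mesh_eqP => i; have [<-|ki] := eqVneq k i.
  by rewrite nbr_in [RHS](congr1 val (nbr_out _ _ jk)) nbr_in nbr_out.
rewrite nbr_out //; have [<-|ji] := eqVneq j i.
  by rewrite !nbr_in nbr_out.
by rewrite !nbr_out.
Qed.

(** The intermediate node takes its k-th coordinate from [x] and the others from the end node. This
    handles the cutoff in [shift_comm]. *)
Lemma nbr_omega d e k j x : k != j -> x \in omega N ->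
  nbr d k (nbr e j x) \in omega N -> nbr e j x \in omega N.
Proof.
move=> kj /omegaP xI /omegaP xI'; apply/omegaP => i.
have [<-|ki] := eqVneq k i; last by have := xI' i; rewrite nbr_out.
by rewrite nbr_out // eq_sym.
Qed.

End Shift.

(** * Truncated shifts and the second differences *)

Section MeshOperators.
Variables (R : realType) (n : nat) (N : 'I_n -> nat) (h : 'I_n -> R).
Hypothesis h_gt0 : forall k, 0 < h k.
Implicit Types (u v w : Hh R N) (k j : 'I_n).

Let q : Hh R N -> Hh R N -> R := dotH h.
Let h_neq0 k : h k != 0. Proof. by rewrite lt0r_neq0. Qed.

Lemma dotH_psd : psd_form q.
Proof.
have hp : 0 <= \prod_k h k by apply: prodr_ge0 => k _; apply: ltW.
split=> [u v|u v w|c u w|u]; rewrite /q /dotH.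
- by congr (_ * _); apply: eq_bigr => x _; rewrite mulrC.
- rewrite -mulrDr -big_split /=; congr (_ * _); apply: eq_bigr => x _.
  by rewrite HvalD mulrDl.
- rewrite [RHS]mulrCA [in RHS]mulr_sumr; congr (_ * _); apply: eq_bigr => x _.
  by rewrite HvalZ mulrA.
- by rewrite mulr_ge0 // sumr_ge0 // => x _; rewrite -expr2 sqr_ge0.
Qed.

(** Translation cut off to 0 on the boundary, so that it acts in [Hh]. The boolean direction makes
    the adjoint a mere negation. *)
Definition shift (up : bool) k w : Hh R N := mkH (fun x => w (nbr up k x)).

Lemma shiftE up k w x :
  Hval (shift up k w) x = if x \in omega N then w (nbr up k x) else 0.
Proof. exact: mkHE. Qed.

Lemma shiftD up k u w : shift up k (u + w) = shift up k u + shift up k w.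
Proof. by apply: HvalP => x xI; rewrite HvalD !shiftE xI HvalD. Qed.

Lemma shiftZ up k c u : shift up k (c *: u) = c *: shift up k u.
Proof. by apply: HvalP => x xI; rewrite HvalZ !shiftE xI HvalZ. Qed.

(** Terms whose neighbour leaves [omega] vanish; on the remaining nodes the two opposite moves are
    mutually inverse changes of variable. *)
Lemma shift_adj up k u v : q (shift up k u) v = q u (shift (~~ up) k v).
Proof.
rewrite /q /dotH; congr (_ * _).
have drop (F : mesh N -> R) (s : mesh N -> mesh N) (w : Hh R N) :
    \sum_(x in omega N) w (s x) * F x =
    \sum_(x | (x \in omega N) && (s x \in omega N)) w (s x) * F x.
  rewrite [LHS](bigID (fun x => s x \in omega N)) /= [X in _ + X]big1 ?addr0 //.
  by move=> x /andP[_ /(HvalN w) ->]; rewrite mul0r.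
under eq_bigr => x xI do rewrite shiftE xI.
under [RHS]eq_bigr => x xI do rewrite shiftE xI mulrC.
rewrite !drop (reindex_onto (nbr (~~ up) k) (nbr up k)); last first.
  by move=> x /andP[xI _]; rewrite nbrK.
have K x : x \in omega N -> nbr up k (nbr (~~ up) k x) = x.
  by rewrite -{1}(negbK up); apply: nbrK.
apply: eq_big => [x|x /andP[_ /eqP ->]]; last by rewrite mulrC.
have [xI|xN] := boolP (x \in omega N); first by rewrite K // xI eqxx !andbT.
by apply/negbTE/negP => /andP[/andP[_ +] /eqP E]; rewrite E (negbTE xN).
Qed.

Lemma shift_comm d e k j w :
  k != j -> shift d k (shift e j w) = shift e j (shift d k w).
Proof.
(* The inner cutoff is harmless: if the intermediate node is outside [omega], so is the end node,
   where [w] vanishes. Along a single direction this fails. *)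
have sh d' e' k' j' x : k' != j' -> x \in omega N ->
    Hval (shift d' k' (shift e' j' w)) x = w (nbr e' j' (nbr d' k' x)).
  move=> kj xI; rewrite !shiftE xI; case: ifPn => // /negP xN.
  rewrite HvalN //; apply/negP => xI'; apply: xN.
  by apply: nbr_omega xI xI'; rewrite eq_sym.
move=> kj; have jk : j != k by rewrite eq_sym.
apply: HvalP => x xI.
by rewrite !sh // nbr_comm.
Qed.

(** The adjoint shift composed with the shift multiplies [w] by the indicator of the nodes whose
    opposite neighbour is interior. *)
Lemma shift_contract up k w : q (shift up k w) (shift up k w) <= q w w.
Proof.
rewrite shift_adj /q /dotH ler_wpM2l //.
  by apply: prodr_ge0 => i _; apply: ltW.
apply: ler_sum => x xI; rewrite !shiftE xI; case: ifP => _.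
  by have := nbrK (~~ up) k xI; rewrite negbK => ->.
by rewrite mulr0 -expr2 sqr_ge0.
Qed.

Lemma LamE_shift k w :
  Lam N h k w = (h k ^+ 2)^-1 *: (shift true k w - 2 *: w + shift false k w).
Proof.
apply: HvalP => x xI.
by rewrite -scaleNr LamE // HvalZ !HvalD HvalZ !shiftE xI mulrC mulNr.
Qed.

Lemma shift_Lam d k j w :
  k != j -> shift d k (Lam N h j w) = Lam N h j (shift d k w).
Proof.
move=> kj; rewrite !LamE_shift shiftZ !shiftD -!scaleNr shiftZ.
by rewrite ![shift _ k (shift _ j _)]shift_comm.
Qed.

Lemma Lam_comm k j w : Lam N h k (Lam N h j w) = Lam N h j (Lam N h k w).
Proof.
have [->//|kj] := eqVneq k j.
rewrite ![Lam N h k _]LamE_shift !shift_Lam //.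
by rewrite -linearZ -linearB -linearD -linearZ.
Qed.

Lemma Lam_sym k : self_adjoint q (Lam N h k).
Proof.
move=> u v; rewrite !LamE_shift !(psdE dotH_psd) !shift_adj /=; ring.
Qed.

(** The two shifts are adjoint, hence have the same quadratic form; expand the squares of S w + w
    and S w - w and use that S is a contraction. *)
Let sum_shift k w :
  `|q (shift true k w) w + q (shift false k w) w| <= 2 * q w w.
Proof.
have -> : q (shift false k w) w = q (shift true k w) w.
  by rewrite shift_adj (psdC dotH_psd).
have := shift_contract true k w.
have := psd_ge0 dotH_psd (shift true k w + w).
have := psd_ge0 dotH_psd (shift true k w - w).
rewrite !(psdE dotH_psd) (psdC dotH_psd w (shift true k w)).
by rewrite ler_norml => *; lra.
Qed.

Lemma Lam_le0 k w : q (Lam N h k w) w <= 0.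
Proof.
rewrite LamE_shift !(psdE dotH_psd).
have := sum_shift k w; rewrite ler_norml => /andP[_ le2].
by rewrite mulr_ge0_le0 ?invr_ge0 ?sqr_ge0 //; lra.
Qed.

Lemma Lam_ge k w : - (4 / h k ^+ 2) * q w w <= q (Lam N h k w) w.
Proof.
rewrite LamE_shift !(psdE dotH_psd).
rewrite (_ : - _ * _ = (h k ^+ 2)^-1 * (- 4 * q w w)); last by ring.
rewrite ler_wpM2l ?invr_ge0 ?sqr_ge0 //.
have := sum_shift k w; rewrite ler_norml => /andP[le2 _]; lra.
Qed.

(** * Symmetry and nonnegativity of [Ah] *)

Variables (a : 'I_n -> R) (ht : R).
Hypothesis cfl : 3^-1 * ht ^+ 2 * (\sum_k a k ^+ 2 / h k ^+ 2) <= 1.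

Let P := Ph N h a ht.
Let L := Lam N h.
Let s := sN R N.

Let PE w : P w = w + (ht ^+ 2 / 12) *: \sum_k a k ^+ 2 *: L k w.
Proof.
rewrite /P /Ph add_lfunE scale_lfunE id_lfunE /Lh sum_lfunE.
by under eq_bigr do rewrite scale_lfunE.
Qed.

Let sE k w : s k w = w + (h k ^+ 2 / 12) *: L k w.
Proof. by rewrite /s (sN_Lam N (h_neq0 k)) add_lfunE scale_lfunE id_lfunE. Qed.

Let psd_suml (I : finType) (F : I -> Hh R N) w :
  q (\sum_i F i) w = \sum_i q (F i) w.
Proof.
apply: (big_morph (q^~ w)) => [u v|]; first exact: psdDl dotH_psd _ _ _.
by rewrite -(scale0r 0) (psdZl dotH_psd) mul0r.
Qed.

Let psd_sumr (I : finType) (F : I -> Hh R N) w :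
  q w (\sum_i F i) = \sum_i q w (F i).
Proof.
rewrite (psdC dotH_psd) psd_suml.
by apply: eq_bigr => i _; apply: psdC dotH_psd _ _.
Qed.

Let P_sym : self_adjoint q P.
Proof.
move=> u v; rewrite !PE !(psdE dotH_psd) psd_suml psd_sumr.
congr (_ + _ * _); apply: eq_bigr => k _.
by rewrite !(psdE dotH_psd) Lam_sym.
Qed.

(** The lower bounds -4 / h_k^2, weighted by a_k^2 ht^2 / 12, add up to minus the left-hand side of
    [cfl]. *)
Let P_ge0 : nonneg_op q P.
Proof.
move=> w; rewrite PE !(psdE dotH_psd) psd_suml.
have : - (4 * \sum_k a k ^+ 2 / h k ^+ 2) * q w w
    <= \sum_k q (a k ^+ 2 *: L k w) w.
  rewrite mulr_sumr -sumrN mulr_suml; apply: ler_sum => k _.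
  rewrite (psdZl dotH_psd); apply: le_trans (ler_wpM2l (sqr_ge0 _) (Lam_ge k w)).
  by rewrite le_eqVlt; apply/orP; left; apply/eqP; ring.
move=> /(ler_wpM2l (_ : 0 <= ht ^+ 2 / 12)) H.
have {}H := H (divr_ge0 (sqr_ge0 ht) (ler0n _ 12)).
have := ler_wpM2r (psd_ge0 dotH_psd w) cfl; lra.
Qed.

(** This and the next two facts carry commutation from the [L k] to [P], to [s k] and to the inverse
    of [s k]. *)
Let comm_P (B : 'End(Hh R N)) :
  (forall k w, B (L k w) = L k (B w)) -> forall w, B (P w) = P (B w).
Proof.
move=> BL w; rewrite !PE linearD linearZ linear_sum /=; congr (_ + _ *: _).
by apply: eq_bigr => k _; rewrite linearZ /= BL.
Qed.

Let comm_s (B : 'End(Hh R N)) k :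
  (forall w, B (L k w) = L k (B w)) -> forall w, B (s k w) = s k (B w).
Proof. by move=> BL w; rewrite !sE linearD linearZ /= BL. Qed.

Let comm_sV k (B : 'End(Hh R N)) :
  (forall w, B (s k w) = s k (B w)) ->
  forall w, B ((s k)^-1%VF w) = (s k)^-1%VF (B w).
Proof.
move=> Bs w; apply/(lker0P (sN_inj R N k)).
by rewrite -Bs !(lker0_lfunVK (sN_inj R N k)).
Qed.

Let s_sym k : self_adjoint q (s k).
Proof. by move=> u v; rewrite !sE !(psdE dotH_psd) Lam_sym. Qed.

Let ssV k w : s k ((s k)^-1%VF w) = w.
Proof. exact: lker0_lfunVK (sN_inj R N k) w. Qed.

Let PL k w : P (L k w) = L k (P w).
Proof. by rewrite -(comm_P (fun j => Lam_comm k j)). Qed.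

Let PsV k w : P ((s k)^-1%VF w) = (s k)^-1%VF (P w).
Proof. by apply: comm_sV w; apply: comm_s; apply: PL. Qed.

Let LsV k w : L k ((s k)^-1%VF w) = (s k)^-1%VF (L k w).
Proof. by apply: comm_sV w; apply: comm_s. Qed.

Lemma AhE w : Ah N h a ht w = - P (\sum_k a k ^+ 2 *: (s k)^-1%VF (L k w)).
Proof.
rewrite /Ah comp_lfunE sum_lfunE -linearN -sumrN; congr (P _).
by apply: eq_bigr => k _; rewrite scale_lfunE comp_lfunE scaleNr.
Qed.

(** Each summand is a product of the commuting self-adjoint operators [P], the inverse of [s k], and
    [L k]. *)
Lemma Ah_sym : self_adjoint q (Ah N h a ht).
Proof.
move=> u v; rewrite !AhE !(psdNl dotH_psd) !(psdNr dotH_psd).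
rewrite !linear_sum /= psd_suml psd_sumr; congr (- _).
apply: eq_bigr => k _; rewrite !linearZ /= !(psdE dotH_psd); congr (_ * _).
have sV_sym : self_adjoint q (s k)^-1%VF.
  exact: self_adjoint_inv (sN_inj R N k) (s_sym k).
by rewrite P_sym sV_sym Lam_sym PsV LsV -PL.
Qed.

Lemma Ah_ge0 : nonneg_op q (Ah N h a ht).
Proof.
move=> w; rewrite AhE (psdNl dotH_psd) linear_sum psd_suml -sumrN sumr_ge0 //.
move=> k _; rewrite linearZ /= (psdZl dotH_psd) -mulrN mulr_ge0 ?sqr_ge0 //.
have h2 : 0 < h k ^+ 2 by rewrite exprn_gt0.
(* Scaled so that 0 <= T <= I, by the spectral bounds [Lam_le0] and [Lam_ge]. *)
pose T : 'End(Hh R N) := - (h k ^+ 2 / 4) *: L k.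
have TE z : T z = - (h k ^+ 2 / 4) *: L k z by rewrite scale_lfunE.
clearbody T.
have T_sym : self_adjoint q T.
  by move=> x y; rewrite !TE !(psdE dotH_psd) Lam_sym.
have T0 : nonneg_op q T.
  move=> z; rewrite TE (psdZl dotH_psd) mulr_le0 ?Lam_le0 //.
  by rewrite oppr_le0 divr_ge0 // ltW.
have T1 z : q (T z) z <= q z z.
  rewrite TE (psdZl dotH_psd) mulNr -mulrN mulrAC ler_pdivrMr // mulrC.
  by rewrite -ler_pdivlMr //; have := Lam_ge k z; lra.
(* On [z = s^-1 w] the form is [(4 / h^2) (D P z, z)], where
   [s = I - T / 3] and [D = T (I - T / 3)]. *)
pose D : 'End(Hh R N) := T - 3^-1 *: (T \o T)%VF.
have DE z : D z = T z - 3^-1 *: T (T z).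
  by rewrite add_lfunE opp_lfunE scale_lfunE comp_lfunE.
clearbody D.
have sT z : s k (T z) = D z.
  rewrite DE sE [T (T z)]TE scalerA -scaleNr; congr (_ + _ *: _).
  by field.
have TT z : 0 <= q (T z) (T z) <= q (T z) z.
  by rewrite (psd_ge0 dotH_psd) (nonneg_op_sqr_le z dotH_psd T_sym T0 T1).
have Dq z : q (D z) z = q (T z) z - 3^-1 * q (T z) (T z).
  by rewrite DE !(psdE dotH_psd) [q (T (T z)) z]T_sym.
have D_sym : self_adjoint q D.
  by move=> x y; rewrite !DE !(psdE dotH_psd) !T_sym.
(* From T^2 <= T follows 2 T / 3 <= D <= T, hence 0 <= D <= I as [nonneg_comp] requires. *)
have D0 : nonneg_op q D.
  by move=> z; rewrite Dq; have /andP[] := TT z; lra.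
have D1 z : q (D z) z <= q z z.
  by rewrite Dq; have /andP[] := TT z; have := T1 z; lra.
have DP z : D (P z) = P (D z).
  have TP y : T (P y) = P (T y) by rewrite !TE linearZ /= PL.
  by rewrite !DE !TP linearB [in RHS]linearZ.
pose z := (s k)^-1%VF w.
have := nonneg_comp dotH_psd D_sym D0 D1 P_ge0 DP z.
rewrite comp_lfunE -sT TE -PL linearZ /= (psdZl dotH_psd) s_sym /z ssV -/z.
have -> : P (L k z) = P ((s k)^-1%VF (L k w)) by rewrite /z LsV.
by rewrite mulNr -mulrN pmulr_rge0 // divr_gt0.
Qed.

End MeshOperators.

(** * Stability bound and energy law for the scheme *)

Theorem theorem1 (R : realType) (n : nat) (a X : 'I_n -> R) (T : R)
  (M : nat) (N : 'I_n -> nat) (ht : R) (h : 'I_n -> R) (eps eps0 : R)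
  (f : nat -> Hh R N) (b : 'I_n -> nat -> Hh R N) (v0 u1 : Hh R N)
  (v : nat -> Hh R N) (vv : 'I_n -> nat -> Hh R N) :
  (1 <= n)%N ->
  (forall k, 0 < a k) -> (forall k, 0 < X k) -> 0 < T ->
  (2 <= M)%N -> (forall k, (2 <= N k)%N) ->
  ht = T / M%:R -> (forall k, h k = X k / (N k)%:R) ->
  0 <= eps < 1 -> 0 < eps0 < 1 ->
  3^-1 * ht ^+ 2 * (\sum_k a k ^+ 2 / h k ^+ 2) <= 1 - eps ->
  leC h ((4^-1 * ht ^+ 2) *: Ah N h a ht) ((1 - eps0 ^+ 2) *: \1%VF) ->
  v 0%N = v0 ->
  (* (a) *)
  (forall m, (1 <= m <= M.-1)%N -> forall x, x \in omega N ->
     Hval (Lamt ht v m) x =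
     Hval (Ph N h a ht (\sum_k a k ^+ 2 *: vv k m) + f m) x) ->
  (* (b) *)
  (forall m k, (0 <= m <= M.-1)%N -> forall x, x \in omega N ->
     Hval (sN R N k (vv k m)) x = Hval (Lam N h k (v m) + b k m) x) ->
  let A := Ah N h a ht in
  let g := fun m => f m + betah h a ht b m in
  let work := fun m => 2 * It ht m.-1 (fun l => dotH h (g l) (mdt ht v l)) in
  ((* (c) *)
   (forall x, x \in omega N ->
     Hval (dt ht v 0) x =
     Hval ((2^-1 * ht) *: Ph N h a ht (\sum_k a k ^+ 2 *: vv k 0%N)
           + u1 + (2^-1 * ht) *: f 0%N) x) ->
   \big[Num.max/0]_(1 <= m < M.+1)
      Num.sqrt (eps0 ^+ 2 * normH h (bdt ht v m) ^+ 2
                + normC h A (bst v m) ^+ 2)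
     <= Num.sqrt (normC h A v0 ^+ 2 + eps0 ^- 2 * normH h u1 ^+ 2)
        + 2 * eps0^-1 * normL1 h ht M g
   /\
   forall m, (1 <= m <= M)%N ->
     energy h a ht v m = energy h a ht v 1 + work m
     /\
     energy h a ht v 1 + work m =
       dotH h (A v0) (st v 0) + dotH h u1 (dt ht v 0)
       + 2^-1 * ht * dotH h (g 0%N) (dt ht v 0) + work m)
  /\
  (forall m, (1 <= m <= M)%N ->
     energy h a ht v m = energy h a ht v 1 + work m).

Proof.
move=> _ _ X_gt0 T_gt0 M_ge2 N_ge2 htE hE /andP[eps_ge0 _] /andP[eps0_gt0 _].
move=> cfl leA <- eq_a eq_b A g work.
have M_gt0 : (0 < M)%N := ltnW M_ge2.
have ht_gt0 : 0 < ht by rewrite htE divr_gt0 // ltr0n.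
have h_gt0 k : 0 < h k by rewrite hE divr_gt0 // ltr0n ltnW.
have {}cfl : 3^-1 * ht ^+ 2 * (\sum_k a k ^+ 2 / h k ^+ 2) <= 1 by lra.
pose q := @dotH R n N h.
have q_psd : psd_form q := dotH_psd N h_gt0.
have A_sym : self_adjoint q A := Ah_sym h_gt0 a ht.
have A_ge0 : nonneg_op q A := Ah_ge0 h_gt0 cfl.
have normH2 w : normH h w ^+ 2 = q w w.
  by rewrite sqr_sqrtr ?(psd_ge0 q_psd).
have normC2 w : normC h A w ^+ 2 = q (A w) w by rewrite sqr_sqrtr ?A_ge0.
have A_le w : 4^-1 * ht ^+ 2 * q (A w) w <= (1 - eps0 ^+ 2) * q w w.
  have : q (((4^-1 * ht ^+ 2) *: A)%VF w) w
    <= q (((1 - eps0 ^+ 2) *: \1)%VF w) w := leA w.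
  by rewrite !scale_lfunE id_lfunE !(psdZl q_psd).
have energyE m : energy h a ht v m = op_energy q A ht v m.
  by rewrite /energy normH2 !normC2.
(* Elimination of the v_kk: [HvalP] lifts (b) from [omega] to an equality in [Hh], and inverting
   [sN] splits v_kk into a part from v, giving [- A (v m)], and a part from b, giving [betah]. *)
have PvvE m : (m <= M.-1)%N ->
    Ph N h a ht (\sum_k a k ^+ 2 *: vv k m) = betah h a ht b m - A (v m).
  move=> mM; rewrite /A AhE opprK /betah -linearD -big_split /=.
  congr (Ph N h a ht _); apply: eq_bigr => k _.
  rewrite -scalerDr -linearD /= addrC -(HvalP (eq_b m k mM)).
  by rewrite (lker0_lfunK (sN_inj R N k)).
have eqn m : (1 <= m <= M.-1)%N -> Lamt ht v m + A (v m) = g m.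
  move=> /[dup] mM /andP[_ mM']; rewrite (HvalP (eq_a m mM)) PvvE //.
  by rewrite /g addrAC subrK addrC.
(* Obtained before (c) is introduced, so that it serves both conjuncts. *)
have law m : (1 <= m <= M)%N -> energy h a ht v m = energy h a ht v 1 + work m.
  by move=> mM; rewrite !energyE (op_energy_law q_psd A_sym ht_gt0 eqn mM).
split=> // eq_c.
have init : dt ht v 0 = u1 + (2^-1 * ht) *: (g 0%N - A (v 0%N)).
  rewrite (HvalP eq_c) PvvE // addrAC -scalerDr addrC /g.
  by congr (_ + _ *: _); rewrite addrC addrA.
split=> [|m mM].
  have := energy_stability q_psd A_sym ht_gt0 A_ge0 eps0_gt0 A_le eqn init M_gt0.
  rewrite normC2 normH2; congr (_ <= _).
  by apply: eq_bigr => m _; rewrite normC2 normH2.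
split; first exact: law.
by congr (_ + _); rewrite energyE (op_energy_init q_psd A_sym ht_gt0 init).
Qed.
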